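(* Let $R$ be a semiprimitive commutative ring with identity. The following statements are equivalent. (a) $\mathrm{Max}(R)=\mathcal{B}(R)$. (b) $\mathrm{Max}(R)$ is discrete. (c) $\mathrm{Max}(R)$ is a fixed-place family.
   Context: $\mathrm{Max}(R)$ is the set of maximal ideals of $R$ with the Zariski (hull-kernel) topology, whose closed sets are the sets $\{M\in\mathrm{Max}(R): S\subseteq M\}$ for $S\subseteq R$. $R$ is semiprimitive if the intersection of all its maximal ideals is $\{0\}$. $\mathrm{Min}(R)$ is the set of minimal prime ideals of $R$. A prime ideal $P_0\in\mathrm{Min}(R)$ is a Bourbaki associated prime divisor of $R$ if $\sqrt{\{0\}}\neq\bigcap_{P_0\neq P\in\mathrm{Min}(R)}P$; $\mathcal{B}(R)$ is the set of all Bourbaki associated prime divisors of $R$. A family $\mathcal{A}$ of prime ideals is a fixed-place family if no element of $\mathcal{A}$ can be omitted from $\bigcap\mathcal{A}$, i.e. $\bigcap(\mathcal{A}\setminus\{P\})\neq\bigcap\mathcal{A}$ for every $P\in\mathcal{A}$. The intersection of the empty family of ideals of $R$ is $R$. *)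

(* Defs.v *)
From HB Require Import structures.
From mathcomp Require Import all_boot all_algebra.
From mathcomp Require Import all_classical topology_structure.

Set Implicit Arguments.
Unset Strict Implicit.
Unset Printing Implicit Defensive.

Import GRing.Theory.

Local Open Scope classical_set_scope.
Local Open Scope ring_scope.

(* Rings are taken in comPzRingType, so the zero ring is allowed, and ideals
   are arbitrary subsets: the predicate idealr_closed of ring_quotient is
   restricted to proper ideals of nonzero rings. *)

Section Ideals.
Variable R : comPzRingType.

Definition ideal (I : set R) : Prop :=
  [/\ I 0, forall x y, I x -> I y -> I (x + y) & forall a x, I x -> I (a * x)].

Definition prime_ideal (P : set R) : Prop :=
  [/\ ideal P, P <> setT & forall x y, P (x * y) -> P x \/ P y].

Definition maximal_ideal (M : set R) : Prop :=
  [/\ ideal M, M <> setT &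
      forall J, ideal J -> J <> setT -> M `<=` J -> J = M].

Definition radical (I : set R) : set R := [set x | exists n, I (x ^+ n)].

End Ideals.

Definition Max (R : comPzRingType) : set (set R) :=
  [set M | maximal_ideal M].

Arguments Max R : clear implicits.

Definition Min (R : comPzRingType) : set (set R) :=
  [set P | prime_ideal P /\
           forall Q, prime_ideal Q -> Q `<=` P -> Q = P].

Arguments Min R : clear implicits.

(* \bigcap over the empty family is setT, i.e. the whole ring. *)
Definition semiprimitive (R : comPzRingType) : Prop :=
  \bigcap_(M in Max R) M = [set 0].

Definition Bourbaki (R : comPzRingType) : set (set R) :=
  [set P0 | Min R P0 /\
            radical [set 0] <> \bigcap_(P in Min R `\ P0) P].

Arguments Bourbaki R : clear implicits.

Definition fixed_place (R : comPzRingType) (A : set (set R)) : Prop :=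
  (forall P, A P -> prime_ideal P) /\
  (forall P, A P -> \bigcap_(Q in A `\ P) Q <> \bigcap_(Q in A) Q).

Lemma maximal_prime (R : comPzRingType) (M : set R) :
  maximal_ideal M -> prime_ideal M.
Proof.
move=> [idM nT maxM]; split=> // x y Mxy.
have [Mx|nMx] := pselect (M x); [by left | right].
have [M0 MD MM] := idM.
pose J := [set z | exists2 m, M m & exists a, z = m + a * x].
have idJ : ideal J.
  split; first by exists 0 => //; exists 0; rewrite mul0r addr0.
    move=> _ _ [m Mm [a ->]] [n Mn [b ->]]; exists (m + n); first exact: MD.
    by exists (a + b); rewrite mulrDl addrACA.
  move=> c _ [m Mm [a ->]]; exists (c * m); first exact: MM.
  by exists (c * a); rewrite mulrDr mulrA.
have MJ : M `<=` J by move=> m Mm; exists m => //; exists 0; rewrite mul0r addr0.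
have [JT|nJT] := pselect (J = setT); last first.
  exfalso; apply: nMx; rewrite -(maxM J idJ nJT MJ).
  by exists 0 => //; exists 1; rewrite mul1r add0r.
have : J 1 by rewrite JT.
move=> [m Mm [a e1]]; rewrite -[y]mul1r e1 mulrDl; apply: MD.
  by rewrite mulrC; exact: MM.
by rewrite -mulrA; exact: MM.
Qed.

Definition MaxSpec (R : comPzRingType) : Type := {M : set R | M \in Max R}.

HB.instance Definition _ (R : comPzRingType) := Choice.on (MaxSpec R).

Section Zariski.
Variable R : comPzRingType.
Implicit Types (S : set R) (U : set (MaxSpec R)).

Definition hull S : set (MaxSpec R) := [set M | S `<=` val M].

Definition zariski_open U : Prop := exists S, ~` U = hull S.

Let zariski_openT : zariski_open setT.
Proof.
exists setT; rewrite setCT predeqE => M; split=> // TM.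
have /set_mem[_ nT _] := valP M; apply: nT.
by rewrite predeqE => x; split=> // _; exact: TM.
Qed.

Let zariski_openI : setI_closed zariski_open.
Proof.
move=> A B [S eS] [T eT].
exists [set z | exists2 x, S x & exists2 y, T y & z = x * y].
rewrite setCI eS eT predeqE => M; have /set_mem/maximal_prime[[_ _ MM] _ pM] := valP M.
split.
  by move=> -[SM|TM] _ [x Sx [y Ty ->]];
    [rewrite mulrC; apply/MM/SM | apply/MM/TM].
move=> STM; have [SM|] := pselect (S `<=` val M); [by left | move=> nSM; right].
have [x [Sx nMx]] : exists x, S x /\ ~ val M x.
  apply: contrapT => nex; apply: nSM => x Sx; apply: contrapT => nMx.
  by apply: nex; exists x.
move=> y Ty; have /pM[//|//] : val M (x * y).
by apply: STM; exists x => //; exists y.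
Qed.

Let zariski_open_bigU (I : Type) (f : I -> set (MaxSpec R)) :
  (forall i, zariski_open (f i)) -> zariski_open (\bigcup_i f i).
Proof.
move=> fop; exists [set x | exists i S, ~` f i = hull S /\ S x].
rewrite setC_bigcup predeqE => M; split.
  by move=> fM x [i [S [eS Sx]]]; have := fM i Logic.I; rewrite eS; exact.
move=> hM i _; have [S eS] := fop i; rewrite eS => x Sx.
by apply: hM; exists i, S.
Qed.

HB.instance Definition _ := isOpenTopological.Build (MaxSpec R)
  zariski_openT zariski_openI zariski_open_bigU.

Lemma closed_hullP (F : set (MaxSpec R)) :
  closed F <-> exists S, F = hull S.
Proof.
have opE U : open U = zariski_open U by [].
by rewrite -openC opE /zariski_open setCK.
Qed.

End Zariski.

(* Main.v *)
Require Import Defs.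
From mathcomp Require Import all_boot all_algebra.
From mathcomp Require Import all_classical topology_structure.

(** All three conditions say that every maximal ideal [M] has an isolator: an
    element lying outside [M] and inside every other maximal ideal.  For (b)
    this is openness of the points of [Max R], since the closed sets are the
    hulls ([discrete_isolators]); for (c) it restates the irredundancy of the
    intersection of [Max R] ([fixed_place_isolators]).

    The link with minimal primes and (a) is that an isolator [x] of [M]
    annihilates [M]: for [y] in [M], the product [x * y] lies in every maximal
    ideal, hence is zero.  So a prime that omits [x] contains [M].  Consequently
    [M] is a minimal prime, and [x] lies in all the other minimal primes, which
    makes [M] a Bourbaki prime ([isolator_bourbaki]).  Conversely, suppose that
    maximal ideals are minimal primes, and let [y] be a non-nilpotent element in
    all the minimal primes but [P].  Some maximal ideal omits [y]; it can only
    be [P], so [P] is maximal and [y] isolates it ([bourbaki_isolator]). *)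

Local Open Scope classical_set_scope.
Import GRing.Theory.
Local Open Scope ring_scope.

Definition isolator (R : comPzRingType) (M : set R) (x : R) : Prop :=
  ~ M x /\ forall N, Max R N -> N <> M -> N x.

Definition has_isolators (R : comPzRingType) : Prop :=
  forall M, Max R M -> exists x, isolator R M x.

Arguments has_isolators R : clear implicits.

Lemma prime_exp (R : comPzRingType) (P : set R) (x : R) n :
  prime_ideal P -> P (x ^+ n) -> P x.
Proof.
move=> [[_ _ PM] _ pP]; elim: n => [|n IHn].
  by rewrite expr0 => P1; rewrite -[x]mulr1; exact: PM.
by rewrite exprS => /pP[].
Qed.

Lemma bigcap_ideal0 (R : comPzRingType) (A : set (set R)) :
  (forall P, A P -> prime_ideal P) -> (\bigcap_(P in A) P) 0.
Proof. by move=> pA P /pA[[]]. Qed.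

Lemma neq_subsetP (T : Type) (A B : set T) :
  A `<=` B -> B <> A -> exists2 x, B x & ~ A x.
Proof.
move=> AB BnA; apply: contrapT => nex; apply: BnA.
apply/seteqP; split=> // x Bx; apply: contrapT => nAx.
by apply: nex; exists x.
Qed.

Section Semiprimitive.
Variable R : comPzRingType.
Hypothesis R_semiprimitive : semiprimitive R.

Lemma semiprimitive_eq0 (x : R) : (forall M, Max R M -> M x) -> x = 0.
Proof.
move=> xM; suff : [set 0] x by [].
by rewrite -R_semiprimitive.
Qed.

Lemma semiprimitive_neq0 (x : R) : x <> 0 -> exists2 M, Max R M & ~ M x.
Proof.
move=> x0; apply: contrapT => nex; apply/x0/semiprimitive_eq0 => M maxM.
by apply: contrapT => nMx; apply: nex; exists M.
Qed.

Lemma semiprimitive_reduced : radical [set 0 : R] = [set 0].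
Proof.
apply/seteqP; split=> [x [n xn0]|x ->]; last by exists 1%N; rewrite expr1.
apply: semiprimitive_eq0 => M /maximal_prime pM; apply: (prime_exp _ _ _ n) => //.
by rewrite xn0; have [[]] := pM.
Qed.

Lemma isolator_mul0 (M : set R) (x y : R) :
  Max R M -> isolator R M x -> M y -> x * y = 0.
Proof.
move=> maxM [_ xN] My; apply: semiprimitive_eq0 => N maxN.
have [[_ _ NM] _ _] := maxN.
have [->|NnM] := pselect (N = M); first by have [[_ _ MM] _ _] := maxM; exact: MM.
by rewrite mulrC; apply: NM; exact: xN.
Qed.

(** As [x] annihilates [M], the product of [x] with any element of [M] lies in
    every prime. *)
Lemma isolator_prime_sub {M P : set R} {x : R} :
  Max R M -> isolator R M x -> prime_ideal P -> ~ P x -> M `<=` P.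
Proof.
move=> maxM xM [[P0 _ _] _ pP] nPx y My.
by have /pP[] : P (x * y) by rewrite (isolator_mul0 M).
Qed.

Lemma isolator_bourbaki {M : set R} {x : R} :
  Max R M -> isolator R M x -> Bourbaki R M.
Proof.
move=> maxM xM; have [nMx _] := xM; split.
  split=> [|Q pQ QM]; first exact: maximal_prime.
  apply/seteqP; split=> //; apply: (isolator_prime_sub maxM xM pQ).
  by move=> /QM.
rewrite semiprimitive_reduced => cap0.
have x0 : x = 0.
  suff : [set 0] x by [].
  rewrite cap0 => P [[pP _] PnM]; apply: contrapT => nPx; apply: PnM.
  have [_ _ topM] := maxM; have [idP PT _] := pP.
  exact: topM idP PT (isolator_prime_sub maxM xM pP nPx).
by apply: nMx; rewrite x0; have [[]] := maxM.
Qed.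

(** The inclusion makes every maximal ideal other than [P] one of the ideals
    in the intersection that defines Bourbaki primes. *)
Lemma bourbaki_isolator {P : set R} :
  Max R `<=` Min R -> Bourbaki R P ->
  Max R P /\ exists x, isolator R P x.
Proof.
move=> MaxMin [_]; rewrite semiprimitive_reduced => /nesym capP.
have [|x xQ /= /semiprimitive_neq0[M maxM nMx]] := neq_subsetP _ _ _ _ capP.
  by move=> _ ->; apply: bigcap_ideal0 => Q [[]].
have xN N : Max R N -> N <> P -> N x.
  by move=> maxN NP; apply: xQ; split=> //; exact: MaxMin.
have MP : M = P by apply: contrapT => /(xN _ maxM).
by rewrite -MP in xN *; split=> //; exists x.
Qed.

Lemma bourbaki_isolators : Max R = Bourbaki R <-> has_isolators R.
Proof.
split=> [aR M maxM|iR].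
  have MaxMin : Max R `<=` Min R by rewrite aR => P [].
  by rewrite aR in maxM; have [] := bourbaki_isolator MaxMin maxM.
have MaxB : Max R `<=` Bourbaki R.
  by move=> M maxM; have [x xM] := iR M maxM; exact: isolator_bourbaki xM.
apply/seteqP; split=> // P BP.
by have [] // := bourbaki_isolator _ BP => M /MaxB[].
Qed.

End Semiprimitive.

(** An isolator [x] of [M] is the same as a principal closed set [hull [set x]]
    that is the complement of the point [M].  If this complement is [hull S]
    for an arbitrary [S], then any element of [S] outside [M] isolates [M]. *)
Lemma discrete_isolators (R : comPzRingType) :
  (forall U : set (MaxSpec R), open U) <-> has_isolators R.
Proof.
split=> [dR M maxM|iR U].
  pose m : MaxSpec R := exist _ M (mem_set maxM).
  have /closed_hullP[S eS] : closed (~` [set m]).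
    by rewrite -openC; exact: dR.
  have [x Sx nMx] : exists2 x, S x & ~ M x.
    apply: contrapT => nex; have : (~` [set m]) m; last exact.
    rewrite eS => x Sx; apply: contrapT => nMx.
    by apply: nex; exists x.
  exists x; split=> // N maxN NM.
  pose n : MaxSpec R := exist _ N (mem_set maxN).
  suff : hull S n by exact.
  by rewrite -eS => nm; apply: NM; exact: (congr1 sval (nm : n = m)).
have open1 (m : MaxSpec R) : open [set m].
  have [x [nmx xN]] := iR _ (set_mem (valP m)).
  rewrite -[[set m]]setCK openC; apply/closed_hullP; exists [set x].
  apply/seteqP; split=> [n nm _ ->|n xn /= nm].
    apply: xN; first exact: set_mem (valP n).
    by move=> /val_inj.
  by apply: nmx; rewrite -nm; exact: xn.
rewrite (_ : U = \bigcup_(m in U) [set m]); first exact: bigcup_open.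
by apply/seteqP; split=> [m Um|m [_ Um ->]] //; exists m.
Qed.

Lemma fixed_place_isolators (R : comPzRingType) :
  fixed_place (Max R) <-> has_isolators R.
Proof.
split=> [[_ fR] M maxM|iR].
  have [|x xN nx] := neq_subsetP _ _ _ _ (fR M maxM).
    by move=> y yM N [maxN _]; exact: yM.
  have {}xN N : Max R N -> N <> M -> N x by move=> maxN NM; exact: xN.
  exists x; split=> // Mx; apply: nx => N maxN.
  by have [->|/(xN _ maxN)] := pselect (N = M).
split=> [P|M maxM capM]; first exact: maximal_prime.
have [x [nMx xN]] := iR M maxM; apply: nMx.
suff : (\bigcap_(N in Max R) N) x by exact.
by rewrite -capM => N [maxN NM]; exact: xN.
Qed.

Local Close Scope ring_scope.

Theorem corollary4p5 (R : comPzRingType) (R_semiprimitive : semiprimitive R) :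
  [<-> (* a *) Max R = Bourbaki R;
       (* b *) forall U : set (MaxSpec R), open U;
       (* c *) fixed_place (Max R)].
Proof.
tfae.
- by move=> /(bourbaki_isolators R R_semiprimitive)/discrete_isolators.
- by move=> /discrete_isolators/fixed_place_isolators.
- by move=> /fixed_place_isolators/(bourbaki_isolators R R_semiprimitive).
Qed.
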